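(* Let $R=D(\sigma,a)$ be a quantum generalized Weyl algebra with $a$ not a unit and $a$ not symmetric. Let $\gamma,\mu\in\Bbbk^\times$ with $n=\mathrm{ord}(\gamma)<\infty$ and $m=\mathrm{ord}(\mu)<\infty$, let $\phi=\eta_{\gamma,\mu}\in\mathrm{Aut}(R)$, and suppose that $n\mid i_0$ (so that $\phi(h)=\gamma h$, $\phi(y)=\mu y$, $\phi(x)=\mu^{-1}x$). If $\gcd(m,n)=1$, then $R^{\langle\phi\rangle}$ is again a quantum generalized Weyl algebra.
   Context: $\Bbbk$ is a field and all algebras are associative $\Bbbk$-algebras. For a commutative algebra $D$, $\sigma\in\mathrm{Aut}(D)$ and $0\neq a\in D$, the generalized Weyl algebra (GWA) $D(\sigma,a)$ is generated over $D$ by $x,y$ subject to $xd=\sigma(d)x$, $yd=\sigma^{-1}(d)y$ ($d\in D$), $yx=a$, $xy=\sigma(a)$. It is quantum if $D=\Bbbk[h]$ or $D=\Bbbk[h^{\pm1}]$ and $\sigma(h)=qh$ with $q\in\Bbbk\setminus\{0,1\}$. Write $a=\sum_{i\in I}a_ih^i$ with $I\subset\mathbb Z$ the finite set of $i$ with $a_i\neq0$, and let $g=\gcd\{i-j: a_ia_j\neq0\}$. If $a$ is a monomial put $C_g=\Bbbk^\times$; otherwise $C_g$ is the group of $g$th roots of unity in $\Bbbk$. Fix $i_0\in I$. For $(\gamma,\mu)\in C_g\times D^\times$, $\eta_{\gamma,\mu}$ is the automorphism of $R$ with $\eta_{\gamma,\mu}(h)=\gamma h$, $\eta_{\gamma,\mu}(y)=y\mu$,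 $\eta_{\gamma,\mu}(x)=\mu^{-1}\gamma^{i_0}x$ (independent of the choice of $i_0\in I$). Whenever $\eta_{\gamma,\mu}$ is written it is understood that $\gamma\in C_g$. A polynomial $a(h)\in\Bbbk[h^{\pm1}]$ is symmetric if there exist $l\in\mathbb Z$ and $\delta,\lambda\in\Bbbk^\times$ with $a(h)=\delta h^la(\lambda h^{-1})$. $\mathrm{ord}(\cdot)$ denotes multiplicative order in $\Bbbk^\times$, and $R^{\langle\phi\rangle}$ is the subring of elements fixed by $\phi$.
   Formalization: ''Quantum'' (parameter not 0 or 1) is concluded only when q^(mn) ≠ 1, as the fixed ring is commutative when q^(mn) = 1 (e.g. q = −1, a = 1+h+h³, γ = 1, μ = −1); in general it is a GWA over k[h'] or k[h'^±1] with σ'(h') = q'h', q' ≠ 0. *)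

(* Defs.v *)
From HB Require Import structures.
From mathcomp Require Import all_boot all_order all_algebra.
From mathcomp Require Import finmap.
From mathcomp Require Import monalg.

Set Implicit Arguments.
Unset Strict Implicit.
Unset Printing Implicit Defensive.

Import Order.TTheory GRing.Theory Num.Theory.
Local Open Scope fset_scope.
Local Open Scope ring_scope.

(* MathComp has no Laurent polynomials, and the monoid algebras of monalg
   require a monoid without nontrivial units; so the convolution product is put
   on the free module {malg k[int]}: f@_i is the coefficient of h^i in f, and
   msupp f is the finite set of those i with f@_i != 0. *)
Definition laurent (k : fieldType) : Type := {malg k[int]}.

Section Laurent.
Variable k : fieldType.
Implicit Types (f g : {malg k[int]}) (i j : int) (c : k).

HB.instance Definition _ := GRing.Lmodule.on (laurent k).

Definition lmon c i : {malg k[int]} := mkmalgU i c.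

Definition lmul f g : {malg k[int]} :=
  \sum_(i <- msupp f) \sum_(j <- msupp g) lmon (f@_i * g@_j) (i + j).

Lemma lmon0 i : lmon 0 i = 0. Proof. exact: monalgU0. Qed.

Lemma lmonD i c d : lmon (c + d) i = lmon c i + lmon d i.
Proof. exact: monalgUD. Qed.

Lemma lmulw (d1 d2 : {fset int}) f g :
  msupp f `<=` d1 -> msupp g `<=` d2 ->
  lmul f g = \sum_(i <- d1) \sum_(j <- d2) lmon (f@_i * g@_j) (i + j).
Proof.
move=> le1 le2; rewrite /lmul (big_fset_incl _ le1) /=.
  apply/eq_bigr=> i _; apply/big_fset_incl => // j _ /mcoeff_outdom ->.
  by rewrite mulr0 lmon0.
move=> i _ /mcoeff_outdom fi; rewrite big1 // => j _.
by rewrite fi mul0r lmon0.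
Qed.

Lemma lmulC : commutative lmul.
Proof.
move=> f g; rewrite /lmul exchange_big; apply: eq_bigr => j _.
by apply: eq_bigr => i _; rewrite mulrC addrC.
Qed.

Lemma lmul0l f : lmul 0 f = 0.
Proof. by rewrite /lmul msupp0 big_seq_fset0. Qed.

Lemma lmulDl : left_distributive lmul +%R.
Proof.
move=> f g h.
rewrite (lmulw (msuppD_le f g) (fsubset_refl (msupp h))).
rewrite (lmulw (fsubsetUl _ (msupp g)) (fsubset_refl (msupp h))).
rewrite (lmulw (fsubsetUr (msupp f) _) (fsubset_refl (msupp h))).
rewrite -big_split /=; apply/eq_bigr=> i _.
rewrite -big_split /=; apply/eq_bigr=> j _.
by rewrite mcoeffD mulrDl lmonD.
Qed.

Lemma lmulDr : right_distributive lmul +%R.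
Proof. by move=> f g h; rewrite lmulC lmulDl !(lmulC f). Qed.

Lemma lmulmm c d i j : lmul (lmon c i) (lmon d j) = lmon (c * d) (i + j).
Proof.
by rewrite (lmulw msuppU_le msuppU_le) !big_seq_fset1 !mcoeffUU.
Qed.

Lemma lsum f : f = \sum_(i <- msupp f) lmon f@_i i.
Proof. exact: monalgE. Qed.

Lemma lmul_suml f g : lmul f g = \sum_(i <- msupp f) lmul (lmon f@_i i) g.
Proof.
by rewrite {1}[f]lsum; apply: (big_morph (lmul^~ g)) => [? ?|];
  rewrite ?lmulDl ?lmul0l.
Qed.

Lemma lmul_sumr f g : lmul f g = \sum_(i <- msupp g) lmul f (lmon g@_i i).
Proof. by rewrite lmulC lmul_suml; apply: eq_bigr => i _; rewrite lmulC. Qed.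

Lemma lmulA : associative lmul.
Proof.
move=> f g h.
have lmul0r u : lmul u 0 = 0 by rewrite lmulC lmul0l.
have suml (I : Type) (r : seq I) (F : I -> {malg k[int]}) u :
    lmul (\sum_(i <- r) F i) u = \sum_(i <- r) lmul (F i) u.
  exact: (big_morph (lmul^~ u) (fun _ _ => lmulDl _ _ _) (lmul0l u)).
have sumr (I : Type) (r : seq I) (F : I -> {malg k[int]}) u :
    lmul u (\sum_(i <- r) F i) = \sum_(i <- r) lmul u (F i).
  exact: (big_morph (lmul u) (fun _ _ => lmulDr _ _ _) (lmul0r u)).
rewrite [f]lsum [g]lsum [h]lsum !suml; apply: eq_bigr => i _.
rewrite [LHS]sumr [X in _ = lmul X _]sumr suml; apply: eq_bigr => j _.
by rewrite !sumr; apply: eq_bigr => l _; rewrite !lmulmm mulrA addrA.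
Qed.

Lemma lmul1l : left_id (lmon 1 0) lmul.
Proof.
move=> f; rewrite lmul_sumr [RHS]lsum.
by apply: eq_bigr => i _; rewrite lmulmm mul1r add0r.
Qed.

Lemma lone_neq0 : lmon 1 0 != 0.
Proof. by rewrite monalgU_eq0 oner_eq0. Qed.

HB.instance Definition _ :=
  GRing.Zmodule_isComNzRing.Build (laurent k)
    lmulA lmulC lmul1l lmulDl lone_neq0.

Lemma lscaleE c f : c *: f = lmul (lmon c 0) f.
Proof.
rewrite lmul_sumr; apply/malgP => i; rewrite mcoeffZ [in LHS](lsum f).
rewrite !raddf_sum mulr_sumr; apply: eq_bigr => j _ /=.
by rewrite lmulmm add0r !mcoeffU mulrnAr.
Qed.

Lemma lscaleAl c (f g : laurent k) : c *: (f * g) = (c *: f) * g.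
Proof.
have E (u : laurent k) : c *: u = (lmon c 0 : laurent k) * u by exact: lscaleE.
by rewrite !E mulrA.
Qed.

HB.instance Definition _ :=
  GRing.Lmodule_isLalgebra.Build k (laurent k) lscaleAl.
HB.instance Definition _ := GRing.Lalgebra_isComAlgebra.Build k (laurent k).

Definition lunit : {pred laurent k} :=
  fun f => size (msupp (f : {malg k[int]})) == 1%N.

Definition lsupp0 f : int := head 0 (msupp f).

Definition linv (f : laurent k) : laurent k :=
  if lunit f then lmon (f@_(lsupp0 f))^-1 (- lsupp0 f) else f.

Lemma lunitP f : lunit f -> f@_(lsupp0 f) != 0 /\ f = lmon f@_(lsupp0 f) (lsupp0 f).
Proof.
rewrite /lunit /lsupp0 [X in _ -> _ /\ X = _]lsum => /eqP sz.
have: forall i, i \in (msupp f : seq int) -> f@_i != 0.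
  by move=> i; rewrite mcoeff_neq0.
case: (enum_fset (msupp f)) sz => [|i [|//]] //= _ H.
by rewrite big_seq1; split=> //; apply: H; rewrite inE.
Qed.

Lemma lmulVx : {in lunit, left_inverse (1 : laurent k) linv *%R}.
Proof.
move=> f fU; rewrite /linv; have -> : lunit f by [].
have [c0 fE] := lunitP fU.
suff: lmul (lmon (f@_(lsupp0 f))^-1 (- lsupp0 f)) f = lmon 1 0 by [].
by rewrite [X in lmul _ X]fE lmulmm mulVf // addNr.
Qed.

Lemma lmul_extremal (r : rel int) f g i j :
    (forall a b, b != j -> r a i -> r b j -> a + b != i + j) ->
    (forall a b, a != i -> r a i -> r b j -> a + b != i + j) ->
    {in msupp f, forall a, r a i} -> {in msupp g, forall b, r b j} ->
    i \in msupp f -> j \in msupp g ->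
  (lmul f g)@_(i + j) != 0.
Proof.
move=> r1 r2 fr gr fi gj; rewrite /lmul raddf_sum /=.
rewrite (big_fsetD1 i) //= [X in _ + X]big_seq [X in _ + X]big1 ?addr0.
  rewrite raddf_sum (big_fsetD1 j) //= [X in _ + X]big_seq [X in _ + X]big1 ?addr0.
    by rewrite mcoeffUU mulf_neq0 // mcoeff_neq0.
  move=> b; rewrite in_fsetD1 => /andP[nb bg].
  by rewrite mcoeffU (negbTE (r1 _ _ nb _ _)) ?fr ?gr.
move=> a; rewrite in_fsetD1 => /andP[na af].
rewrite raddf_sum big_seq big1 // => b bg.
by rewrite /= mcoeffU (negbTE (r2 _ _ na _ _)) ?fr ?gr.
Qed.

Lemma exists_max (s : seq int) : s != [::] ->
  exists2 i, i \in s & {in s, forall j, j <= i}.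
Proof.
elim: s => // a [|b s] IH _.
  by exists a; rewrite ?inE // => j; rewrite inE => /eqP ->.
have [//|i si le] := IH; case: (leP a i) => ai.
  exists i; first by rewrite inE si orbT.
  by move=> j; rewrite inE => /orP[/eqP ->|/le].
exists a; first by rewrite inE eqxx.
move=> j; rewrite inE => /orP[/eqP ->|/le h] //.
exact: le_trans h (ltW ai).
Qed.

Lemma exists_min (s : seq int) : s != [::] ->
  exists2 i, i \in s & {in s, forall j, i <= j}.
Proof.
move=> s0; have [|i] := @exists_max (map -%R s); first by case: (s) s0.
move=> /mapP[a sa ->] H; exists a => // j sj.
by rewrite -lerN2 H // map_f.
Qed.

Lemma lunitPl (f g : laurent k) : g * f = 1 -> lunit f.
Proof.
move=> gf1.
have nz (u : {malg k[int]}) : u != 0 -> (msupp u : seq int) != [::].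
  apply: contra => /eqP E; apply/eqP; rewrite [u]lsum E.
  by rewrite big_nil.
have f0 : (f : {malg k[int]}) != 0.
  by apply: contra_eq_neq gf1 => ->; rewrite mulr0 eq_sym oner_eq0.
have g0 : (g : {malg k[int]}) != 0.
  by apply: contra_eq_neq gf1 => ->; rewrite mul0r eq_sym oner_eq0.
have [fM fM1 fM2] := exists_max (nz _ f0).
have [fm fm1 fm2] := exists_min (nz _ f0).
have [gM gM1 gM2] := exists_max (nz _ g0).
have [gm gm1 gm2] := exists_min (nz _ g0).
have deg n : (lmul g f)@_n != 0 -> n = 0.
  have -> : lmul g f = lmon 1 0 by exact: gf1.
  by rewrite mcoeffU; case: (eqVneq 0 n) => // _; rewrite eqxx.
have M0 : gM + fM = 0.
  apply: deg; apply: (@lmul_extremal (fun a b => a <= b)) => //.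
    move=> a b nb le1 le2; apply: contra nb => /eqP E.
    by rewrite eq_le le2 -(lerD2l gM) -E lerD2r.
  move=> a b na le1 le2; apply: contra na => /eqP E.
  by rewrite eq_le le1 -(lerD2r fM) -E lerD2l.
have m0 : gm + fm = 0.
  apply: deg; apply: (@lmul_extremal (fun a b => b <= a)) => //.
    move=> a b nb le1 le2; apply: contra nb => /eqP E.
    by rewrite eq_le le2 -(lerD2l gm) -E lerD2r le1.
  move=> a b na le1 le2; apply: contra na => /eqP E.
  by rewrite eq_le le1 -(lerD2r fm) -E lerD2l le2.
have fMm : fM = fm.
  apply/eqP; rewrite eq_le (fm2 _ fM1) andbT.
  have -> : fM = - gM by apply/eqP; rewrite -addr_eq0 addrC M0.
  have -> : fm = - gm by apply/eqP; rewrite -addr_eq0 addrC m0.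
  by rewrite lerN2 gm2.
rewrite /lunit; have -> : msupp (f : {malg k[int]}) = [fset fM].
  apply/fsetP => i; rewrite in_fset1; apply/idP/eqP => [fi|->//].
  by apply/eqP; rewrite eq_le fM2 // fMm fm2.
by rewrite cardfs1.
Qed.

Lemma linv_out : {in [predC lunit], linv =1 id}.
Proof.
by move=> f fN; rewrite /linv; have -> : lunit f = false by apply/negbTE.
Qed.

HB.instance Definition _ :=
  GRing.ComNzRing_hasMulInverse.Build (laurent k) lmulVx lunitPl linv_out.


Definition lvar : laurent k := lmon 1 1.

Definition lcoef (f : laurent k) (i : int) : k := (f : {malg k[int]})@_i.

Definition lsupp (f : laurent k) : {fset int} := msupp (f : {malg k[int]}).

(* f evaluated at a unit u of the Laurent polynomial ring; as u is a unit,
   u ^ i makes sense for every integer i. *)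
Definition leval (f u : laurent k) : laurent k :=
  \sum_(i <- lsupp f) lcoef f i *: u ^ i.

Definition lsymmetric (f : laurent k) : Prop :=
  exists (l : int) (delta lambda : k),
    [/\ delta != 0, lambda != 0
      & f = delta *: (lvar ^ l * leval f (lambda *: lvar^-1))].

Definition laurent_of_poly (p : {poly k}) : laurent k :=
  \sum_(i < size p) p`_i *: lvar ^+ i.

Definition lmonomial (f : laurent k) : bool := #|` lsupp f| == 1%N.

Definition exp_gcd (f : laurent k) : nat :=
  \big[gcdn/0%N]_(i <- lsupp f) \big[gcdn/0%N]_(j <- lsupp f) `|i - j|%N.

Definition in_Cg (f : laurent k) (gamma : k) : bool :=
  if lmonomial f then gamma != 0 else gamma ^+ exp_gcd f == 1.

End Laurent.

Record alg_aut (k : fieldType) (A : algType k) := AlgAut {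
  aut_fun :> {lrmorphism A -> A};
  aut_inv : {lrmorphism A -> A};
  aut_funK : cancel aut_fun aut_inv;
  aut_invK : cancel aut_inv aut_fun
}.

Section GWA.
Variables (k : fieldType) (D : comAlgType k) (sigma : alg_aut D) (a : D).

Definition gwa_relations (A : algType k) (j : {lrmorphism D -> A}) (x y : A) :
    Prop :=
  [/\ forall d, x * j d = j (sigma d) * x,
      forall d, y * j d = j (aut_inv sigma d) * y,
      y * x = j a
    & x * y = j (sigma a)].

(* R, together with D -> R and x, y in R, is presented by the generators x, y
   over D and the relations above: it is initial among the D-rings with two
   elements satisfying these relations. *)
Record gwa (R : algType k) := GWA {
  gwa_incl : {lrmorphism D -> R};
  gwa_x : R;
  gwa_y : R;
  gwa_rel : gwa_relations gwa_incl gwa_x gwa_y;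
  gwa_lift : forall (A : algType k) (j : {lrmorphism D -> A}) (u v : A),
    gwa_relations j u v ->
    exists f : {lrmorphism R -> A},
      [/\ forall d, f (gwa_incl d) = j d, f gwa_x = u & f gwa_y = v];
  gwa_lift_unique : forall (A : algType k) (f g : {lrmorphism R -> A}),
    (forall d, f (gwa_incl d) = g (gwa_incl d)) ->
    f gwa_x = g gwa_x -> f gwa_y = g gwa_y -> f =1 g
}.
End GWA.

Variant base_kind := PolyBase | LaurentBase.

Section Quantum.
Variable k : fieldType.

Definition base_ring (b : base_kind) : comUnitAlgType k :=
  match b with
  | PolyBase => {poly k} : comUnitAlgType k
  | LaurentBase => laurent k : comUnitAlgType k
  end.

Definition base_var (b : base_kind) : base_ring b :=
  match b return base_ring b with
  | PolyBase => 'X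
  | LaurentBase => lvar k
  end.

Definition base_to_laurent (b : base_kind) : base_ring b -> laurent k :=
  match b return base_ring b -> laurent k with
  | PolyBase => @laurent_of_poly k
  | LaurentBase => id
  end.

(* D(sigma, a) with D = k[h] or k[h, h^-1] and sigma(h) = q h, where q = 1 is
   not excluded. The fixed ring of eta_(gamma, mu) has parameter q ^ (m n), which
   can be 1 when q is a root of unity; that fixed ring is then commutative, hence
   not a quantum GWA. *)
Record scaling_gwa (R : algType k) := ScalingGWA {
  q_base : base_kind;
  q_param : k;
  q_param_neq0 : q_param != 0;
  q_sigma : alg_aut (base_ring q_base);
  q_sigma_var : q_sigma (base_var q_base) = q_param *: base_var q_base;
  q_a : base_ring q_base;
  q_a_neq0 : q_a != 0;
  q_gwa :> gwa q_sigma q_a R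
}.

Record quantum_gwa (R : algType k) := QuantumGWA {
  q_scaling :> scaling_gwa R;
  q_param_neq1 : q_param q_scaling != 1
}.

Definition q_laurent (R : algType k) (W : scaling_gwa R) : laurent k :=
  base_to_laurent (q_a W).

(* phi = eta_(gamma, mu), for mu in D^* and i0 in the support of a. *)
Definition is_eta (R : algType k) (W : scaling_gwa R) (i0 : int) (gamma : k)
    (mu : base_ring (q_base W)) (phi : alg_aut R) : Prop :=
  [/\ i0 \in lsupp (q_laurent W), in_Cg (q_laurent W) gamma
    & mu \is a GRing.unit] /\
  [/\ phi (gwa_incl W (base_var (q_base W)))
        = gamma *: gwa_incl W (base_var (q_base W)),
      phi (gwa_y W) = gwa_y W * gwa_incl W mu
    & phi (gwa_x W) = gwa_incl W mu^-1 * (gamma ^ i0 *: gwa_x W)].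
End Quantum.

Arguments is_eta {k R} W i0 gamma mu phi.

Section FixedRing.
Variables (k : fieldType) (R : algType k) (phi : alg_aut R).

Definition fixed_pred : {pred R} := [pred r | phi r == r].

Fact fixed_subalg_closed : subalg_closed fixed_pred.
Proof.
split=> [|c u v|u v]; rewrite !inE ?rmorph1 // => /eqP uE /eqP vE.
  by rewrite linearP /= uE vE.
by rewrite rmorphM /= uE vE.
Qed.

HB.instance Definition _ :=
  GRing.isSubalgClosed.Build k R fixed_pred fixed_subalg_closed.

Record fixed_ring : predArgType :=
  FixedRing { fixed_val :> R; _ : fixed_val \in fixed_pred }.

HB.instance Definition _ := [isSub for fixed_val].
HB.instance Definition _ := [Choice of fixed_ring by <:].
HB.instance Definition _ := [SubChoice_isSubAlgebra of fixed_ring by <:].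
End FixedRing.

(* Main.v *)
(* The universal property makes R the free left D-module on the monomials
   ..., y^2, y, 1, x, x^2, ...: they span because the span is a subalgebra, and
   they are independent because x |-> x, y |-> a x^-1 maps R to a skew Laurent
   ring over the domain D. Conversely, a D-ring with the defining relations and
   such a basis is the generalized Weyl algebra, as all products of
   monomials are determined by the relations.
   Now phi multiplies h^j x^i by gamma^j mu^-i and h^j y^i by gamma^j mu^i. As
   m and n are coprime, the fixed ones are those with n | j and m | i; hence the
   fixed ring is free over k[h^n] or k[h^n, h^-n] on the monomials in x^m and
   y^m, and x^m, y^m satisfy the relations of a generalized Weyl algebra with
   parameter q^(m n) and a' = y^m x^m. *)

From HB Require Import structures.
Require Import Defs.
From mathcomp Require Import all_boot all_order all_algebra.
From mathcomp Require Import finmap monalg boolp.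

Set Implicit Arguments.
Unset Strict Implicit.
Unset Printing Implicit Defensive.

Import Order.TTheory GRing.Theory Num.Theory.
Local Open Scope fset_scope.
Local Open Scope ring_scope.

Definition lrmorphism_of (k : fieldType) (A B : algType k) (f : A -> B)
    (fB : zmod_morphism f) (fZ : scalable f) (fM : monoid_morphism f) :
  {lrmorphism A -> B} :=
  HB.pack f (GRing.isZmodMorphism.Build A B f fB)
    (GRing.isScalable.Build k A B *:%R f fZ)
    (GRing.isMonoidMorphism.Build A B f fM).

(** * Integer powers of an automorphism *)

Section AutIter.
Variables (k : fieldType) (D : comAlgType k) (s : alg_aut D).
Implicit Types (i j : int) (d e : D).

Definition aut_iter i d : D :=
  match i with
  | Posz n => iter n s d
  | Negz n => iter n.+1 (aut_inv s) d
  end.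

Lemma aut_iter_is_linear i : linear (aut_iter i).
Proof.
case: i => n c d e; first by elim: n => //= n ->; rewrite linearP.
by elim: n => /= [|n ->]; rewrite linearP.
Qed.

Lemma aut_iter_is_multiplicative i : monoid_morphism (aut_iter i).
Proof.
case: i => n; split=> [|d e].
- by elim: n => //= n ->; rewrite rmorph1.
- by elim: n => //= n ->; rewrite rmorphM.
- by elim: n => /= [|n ->]; rewrite rmorph1.
- by elim: n => /= [|n ->]; rewrite rmorphM.
Qed.

HB.instance Definition _ i :=
  GRing.isLinear.Build k D D *:%R (aut_iter i) (aut_iter_is_linear i).
HB.instance Definition _ i :=
  GRing.isMonoidMorphism.Build D D (aut_iter i) (aut_iter_is_multiplicative i).

Lemma aut_iterS i d : aut_iter (i + 1) d = s (aut_iter i d).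
Proof. by case: i => [n|[|n]] /=; rewrite ?addn1 //= ?aut_invK ?subn1. Qed.

Lemma aut_iterP i d : aut_iter (i - 1) d = aut_inv s (aut_iter i d).
Proof. by rewrite -[in RHS](subrK 1 i) aut_iterS aut_funK. Qed.

Lemma aut_iterD i j d : aut_iter (i + j) d = aut_iter i (aut_iter j d).
Proof.
elim: i => [|n IH|n IH]; first by rewrite add0r.
  by rewrite -addn1 PoszD addrAC !aut_iterS IH.
by rewrite -addn1 PoszD opprD addrAC !aut_iterP IH.
Qed.

Lemma aut_iter_inj i : injective (aut_iter i).
Proof.
by apply: (can_inj (g := aut_iter (- i))) => d; rewrite -aut_iterD addNr.
Qed.

End AutIter.

(** * The skew Laurent ring over D *)

Section Skew.
Variables (k : fieldType) (D : comAlgType k) (s : alg_aut D).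
Implicit Types (f g h : {malg D[int]}) (i j : int) (d e : D).

(** With [<< d *g i >>] read as d x^i, this is the product determined by x d = s(d) x and x
    invertible. *)
Definition skew_mul f g : {malg D[int]} :=
  \sum_(i <- msupp f) \sum_(j <- msupp g)
    << f@_i * aut_iter s i g@_j *g i + j >>.

(** Enlarging the index sets adds only zero terms. Distributivity needs this because the support of
    a sum may be smaller than the union of the supports. *)
Lemma skew_mulw (E1 E2 : {fset int}) f g :
  msupp f `<=` E1 -> msupp g `<=` E2 ->
  skew_mul f g =
    \sum_(i <- E1) \sum_(j <- E2) << f@_i * aut_iter s i g@_j *g i + j >>.
Proof.
move=> le1 le2; rewrite /skew_mul (big_fset_incl _ le1) /=.
  apply/eq_bigr=> i _; apply/big_fset_incl => // j _ /mcoeff_outdom ->.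
  by rewrite raddf0 mulr0 monalgU0.
move=> i _ /mcoeff_outdom fi; rewrite big1 // => j _.
by rewrite fi mul0r monalgU0.
Qed.

Lemma skew_mulDl : left_distributive skew_mul +%R.
Proof.
move=> f g h.
rewrite (skew_mulw (msuppD_le f g) (fsubset_refl (msupp h))).
rewrite (skew_mulw (fsubsetUl _ (msupp g)) (fsubset_refl (msupp h))).
rewrite (skew_mulw (fsubsetUr (msupp f) _) (fsubset_refl (msupp h))).
rewrite -big_split /=; apply/eq_bigr=> i _.
rewrite -big_split /=; apply/eq_bigr=> j _.
by rewrite mcoeffD mulrDl monalgUD.
Qed.

Lemma skew_mulDr : right_distributive skew_mul +%R.
Proof.
move=> h f g.
rewrite (skew_mulw (fsubset_refl (msupp h)) (msuppD_le f g)).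
rewrite (skew_mulw (fsubset_refl (msupp h)) (fsubsetUl _ (msupp g))).
rewrite (skew_mulw (fsubset_refl (msupp h)) (fsubsetUr (msupp f) _)).
rewrite -big_split /=; apply/eq_bigr=> i _.
rewrite -big_split /=; apply/eq_bigr=> j _.
by rewrite mcoeffD raddfD mulrDr monalgUD.
Qed.

Lemma skew_mul0l f : skew_mul 0 f = 0.
Proof. by rewrite /skew_mul msupp0 big_seq_fset0. Qed.

Lemma skew_mul0r f : skew_mul f 0 = 0.
Proof. by rewrite /skew_mul big1 // => i _; rewrite msupp0 big_seq_fset0. Qed.

Lemma skew_mulUU d e i j :
  skew_mul << d *g i >> << e *g j >> = << d * aut_iter s i e *g i + j >>.
Proof.
by rewrite (skew_mulw msuppU_le msuppU_le) !big_seq_fset1 !mcoeffUU.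
Qed.

Lemma skew_mul_suml (I : Type) (r : seq I) (F : I -> {malg D[int]}) g :
  skew_mul (\sum_(i <- r) F i) g = \sum_(i <- r) skew_mul (F i) g.
Proof.
exact: (big_morph (skew_mul^~ g) (fun _ _ => skew_mulDl _ _ _) (skew_mul0l g)).
Qed.

Lemma skew_mul_sumr (I : Type) (r : seq I) (F : I -> {malg D[int]}) g :
  skew_mul g (\sum_(i <- r) F i) = \sum_(i <- r) skew_mul g (F i).
Proof.
exact: (big_morph (skew_mul g) (fun _ _ => skew_mulDr _ _ _) (skew_mul0r g)).
Qed.

Lemma skew_mulA : associative skew_mul.
Proof.
move=> f g h; rewrite [f]monalgE [g]monalgE [h]monalgE.
rewrite !skew_mul_suml; apply: eq_bigr => i _.
rewrite [LHS]skew_mul_sumr [X in _ = skew_mul X _]skew_mul_sumr skew_mul_suml.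
apply: eq_bigr => j _.
rewrite !skew_mul_sumr; apply: eq_bigr => l _.
by rewrite !skew_mulUU rmorphM aut_iterD !mulrA addrA.
Qed.

Lemma skew_mul1l : left_id << 1 *g 0 >> skew_mul.
Proof.
move=> f; rewrite [f]monalgE skew_mul_sumr.
by apply: eq_bigr => i _; rewrite skew_mulUU mul1r add0r.
Qed.

Lemma skew_mul1r : right_id << 1 *g 0 >> skew_mul.
Proof.
move=> f; rewrite [f]monalgE skew_mul_suml.
by apply: eq_bigr => i _; rewrite skew_mulUU rmorph1 mulr1 addr0.
Qed.

Lemma skew_one_neq0 : << 1 *g 0 >> != 0 :> {malg D[int]}.
Proof. by rewrite monalgU_eq0 oner_eq0. Qed.

End Skew.

(** The argument [s] labels the type, so that the products belonging to different automorphisms are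
    kept apart. *)
Definition skew (k : fieldType) (D : comAlgType k) (s : alg_aut D) : Type :=
  {malg D[int]}.

Section SkewAlgebra.
Variables (k : fieldType) (D : comAlgType k) (s : alg_aut D).

HB.instance Definition _ := GRing.Zmodule.on (skew s).
HB.instance Definition _ := GRing.Zmodule_isNzRing.Build (skew s)
  (skew_mulA s) (skew_mul1l s) (skew_mul1r s) (skew_mulDl s) (skew_mulDr s)
  (skew_one_neq0 D).

(** The free module is a module over D; its scalars are restricted along k -> D. *)
Definition skew_scale (c : k) (f : skew s) : skew s :=
  (c%:A : D) *: (f : {malg D[int]}).

Lemma skew_scaleA c d f :
  skew_scale c (skew_scale d f) = skew_scale (c * d) f.
Proof. by rewrite /skew_scale scalerA -scalerAl mul1r scalerA. Qed.
Lemma skew_scale1 : left_id 1 skew_scale.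
Proof. by move=> f; rewrite /skew_scale !scale1r. Qed.
Lemma skew_scaleDr : right_distributive skew_scale +%R.
Proof. by move=> c f g; rewrite /skew_scale scalerDr. Qed.
Lemma skew_scaleDl f : {morph skew_scale^~ f : c d / c + d}.
Proof. by move=> c d; rewrite /skew_scale !scalerDl. Qed.

HB.instance Definition _ := GRing.Zmodule_isLmodule.Build k (skew s)
  skew_scaleA skew_scale1 skew_scaleDr skew_scaleDl.

Lemma skew_scaleE c (f : {malg D[int]}) :
  skew_scale c f = skew_mul s << c%:A *g 0 >> f.
Proof.
rewrite {2}[f]monalgE skew_mul_sumr /skew_scale {1}[f]monalgE scaler_sumr.
apply: eq_bigr => i _; rewrite skew_mulUU add0r /=.
by apply/malgP=> j; rewrite mcoeffZ !mcoeffU mulrnAr.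
Qed.

(** Powers of [s] are k-linear and so fix the image of k. Together with [skew_scaleE] this makes
    scalars central, as an algebra over k requires. *)
Lemma skew_scaleEr c (f : {malg D[int]}) :
  skew_scale c f = skew_mul s f << c%:A *g 0 >>.
Proof.
rewrite {2}[f]monalgE skew_mul_suml /skew_scale {1}[f]monalgE scaler_sumr.
apply: eq_bigr => i _; rewrite skew_mulUU addr0 linearZ rmorph1 mulrC.
by apply/malgP=> j; rewrite mcoeffZ !mcoeffU mulrnAr.
Qed.

Fact skew_scaleAl c (f g : skew s) : c *: (f * g) = (c *: f) * g.
Proof.
by rewrite /GRing.scale /= !skew_scaleE -[RHS](skew_mulA s).
Qed.

HB.instance Definition _ := GRing.Lmodule_isLalgebra.Build k (skew s)
  skew_scaleAl.

Fact skew_scaleAr c (f g : skew s) : c *: (f * g) = f * (c *: g).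
Proof.
by rewrite /GRing.scale /= !skew_scaleEr -[LHS](skew_mulA s).
Qed.

HB.instance Definition _ := GRing.Lalgebra_isAlgebra.Build k (skew s)
  skew_scaleAr.

Definition skew_const (d : D) : skew s := << d *g 0 >>.

Fact skew_const_linear : linear skew_const.
Proof.
move=> c d e; rewrite /skew_const monalgUD; congr (_ + _).
rewrite /GRing.scale /= skew_scaleE skew_mulUU addr0 /=.
by rewrite -scalerAl mul1r.
Qed.
Fact skew_const_multiplicative : monoid_morphism skew_const.
Proof. by split=> // d e; rewrite [RHS]skew_mulUU. Qed.

HB.instance Definition _ :=
  GRing.isLinear.Build k D (skew s) *:%R skew_const skew_const_linear.
HB.instance Definition _ :=
  GRing.isMonoidMorphism.Build D (skew s) skew_const skew_const_multiplicative.

End SkewAlgebra.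

(** * Monomials in x and y, and recognition of a generalized Weyl algebra by its basis *)

Section Monomials.
Variables (k : fieldType) (D : comAlgType k) (s : alg_aut D) (a : D).

Section Basic.
Variables (A : algType k) (j : {lrmorphism D -> A}) (x y : A).

(** The monomial of degree i for the grading with x in degree 1 and y in degree -1; [Negz n] is
    -(n+1). *)
Definition gmon (i : int) : A :=
  match i with Posz n => x ^+ n | Negz n => y ^+ n.+1 end.

Lemma gmonN (n : nat) : gmon (- n%:Z) = y ^+ n.
Proof. by case: n. Qed.

(** The left D-linear map from the free module on the integers: surjective when the monomials span,
    with zero kernel when they are independent. *)
Definition gsum : {malg D[int]} -> A := mmap j gmon.

HB.instance Definition _ := GRing.Additive.on gsum.

Lemma gsumE (f : {malg D[int]}) :
  gsum f = \sum_(i <- msupp f) j f@_i * gmon i.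
Proof. exact: mmapE. Qed.

Lemma gsumU d i : gsum << d *g i >> = j d * gmon i.
Proof. exact: mmapU. Qed.

Hypothesis rel : gwa_relations s a j x y.

Lemma gmon_comm i d : gmon i * j d = j (aut_iter s i d) * gmon i.
Proof.
have [xd yd _ _] := rel; case: i => n /=.
  elim: n => [|n IH]; first by rewrite expr0 mul1r mulr1.
  by rewrite exprS -mulrA IH mulrA xd mulrA.
elim: n => [|n IH]; first by rewrite expr1 yd.
by rewrite exprS -mulrA IH mulrA yd mulrA.
Qed.

(** In negative degree the factor x meets a leading y and the pair collapses to s(a). *)
Lemma x_gmon i : x * gmon i = j (if 0 <= i then 1 else s a) * gmon (i + 1).
Proof.
have [_ _ _ xy] := rel; case: i => n /=.
  by rewrite rmorph1 mul1r addn1 exprS.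
rewrite exprS mulrA xy NegzE -addn1 PoszD opprD -addrA addNr addr0.
by rewrite gmonN.
Qed.

Lemma y_gmon i : y * gmon i = j (if i <= 0 then 1 else a) * gmon (i - 1).
Proof.
have [_ _ yx _] := rel; case: i => [[|n]|n] /=.
- by rewrite rmorph1 !mulr1 expr1 mul1r.
- by rewrite exprS mulrA yx /= subn1.
- by rewrite rmorph1 mul1r addn0 -exprS.
Qed.
End Basic.

(* The coefficient c depends only on the relations, not on the ring in which
   they hold. *)
Lemma gmonM i l : exists c : D,
  forall (A : algType k) (j : {lrmorphism D -> A}) (x y : A),
    gwa_relations s a j x y ->
    gmon x y i * gmon x y l = j c * gmon x y (i + l).
Proof.
elim: i => [|n [c IH]|n [c IH]].
- by exists 1 => A j x y _; rewrite add0r rmorph1 /= expr0.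
- exists (s c * (if 0 <= n%:Z + l then 1 else s a)) => A j x y rel.
  have [xd _ _ _] := rel.
  rewrite [gmon x y n.+1]exprS -mulrA [X in x * X](IH _ _ _ _ rel) mulrA xd.
  rewrite -mulrA (x_gmon rel) mulrA -rmorphM; congr (j _ * gmon x y _).
  by rewrite -addn1 PoszD addrAC.
- exists (aut_inv s c * (if - n%:Z + l <= 0 then 1 else a)) => A j x y rel.
  have [_ yd _ _] := rel.
  rewrite gmonN exprS -mulrA -(gmonN x) (IH _ _ _ _ rel) mulrA yd.
  rewrite -mulrA (y_gmon rel) mulrA -rmorphM; congr (j _ * gmon x y _).
  by rewrite -addn1 PoszD opprD addrAC.
Qed.

(** As in [gmonM], the expansion [f] is chosen before the ring. A map matching coefficients between
    two such rings is therefore multiplicative. *)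
Lemma gsumUM d e i l : exists f : {malg D[int]},
  forall (A : algType k) (j : {lrmorphism D -> A}) (x y : A),
    gwa_relations s a j x y ->
    (j d * gmon x y i) * (j e * gmon x y l) = gsum j x y f.
Proof.
have [c cE] := gmonM i l.
exists << d * aut_iter s i e * c *g i + l >> => A j x y rel.
rewrite gsumU -mulrA [X in j d * X]mulrA (gmon_comm rel) -mulrA.
rewrite (cE _ _ _ _ rel).
by rewrite !rmorphM !mulrA.
Qed.

Section Recognition.
Variables (B : algType k) (jB : {lrmorphism D -> B}) (xB yB : B).
Hypothesis relB : gwa_relations s a jB xB yB.
Hypothesis span : forall b, exists f, gsum jB xB yB f = b.
Hypothesis free : forall f, gsum jB xB yB f = 0 -> f = 0.

(** The boolean equality lets [xchoose] pick coefficients. *)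
Fact span_eq b : exists f, gsum jB xB yB f == b.
Proof. by have [f <-] := span b; exists f. Qed.

Definition gcoef b : {malg D[int]} := xchoose (span_eq b).

Lemma gcoefK : cancel gcoef (gsum jB xB yB).
Proof. by move=> b; apply/eqP/(xchooseP (span_eq b)). Qed.

Lemma gsumK : cancel (gsum jB xB yB) gcoef.
Proof.
move=> f; apply/eqP; rewrite -subr_eq0 (free (f := _ - _)) //.
by rewrite raddfB /= gcoefK subrr.
Qed.

Lemma gcoef_is_additive : zmod_morphism gcoef.
Proof.
by move=> b c; apply: (can_inj gsumK); rewrite raddfB /= !gcoefK.
Qed.
HB.instance Definition _ :=
  GRing.isZmodMorphism.Build B _ gcoef gcoef_is_additive.

(** The lift [F] reads off the coefficients in B and evaluates them at [u] and [v]. It is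
    multiplicative because [gsumUM] expands a product of two terms by the same coefficients in B and
    in A. *)
Lemma gwa_lift_of_basis (A : algType k) (j : {lrmorphism D -> A}) (u v : A) :
  gwa_relations s a j u v ->
  exists f : {lrmorphism B -> A},
    [/\ forall d, f (jB d) = j d, f xB = u & f yB = v].
Proof.
move=> rel; pose F b := gsum j u v (gcoef b).
have FU d i : F (jB d * gmon xB yB i) = j d * gmon u v i.
  by rewrite /F -gsumU gsumK gsumU.
have Fj d : F (jB d) = j d by rewrite -[jB d]mulr1 (FU d 0) mulr1.
have Fx : F xB = u by have := FU 1 1; rewrite !rmorph1 !mul1r.
have Fy : F yB = v by have := FU 1 (-1); rewrite !rmorph1 !mul1r.
have FD : zmod_morphism F by move=> b c; rewrite /F !raddfB.
pose Fa : {additive B -> A} := HB.pack F (GRing.isZmodMorphism.Build B A F FD).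
have FM b c : F (b * c) = F b * F c.
  rewrite -[b]gcoefK -[c]gcoefK !gsumE.
  rewrite -![F _]/(Fa _) mulr_suml !raddf_sum mulr_suml; apply: eq_bigr => i _.
  rewrite mulr_sumr !raddf_sum mulr_sumr; apply: eq_bigr => l _.
  rewrite /Fa /= !FU; have [f fE] := gsumUM (gcoef b)@_i (gcoef c)@_l i l.
  by rewrite (fE _ _ _ _ relB) (fE _ _ _ _ rel) /F gsumK.
have F1 : F 1 = 1 by rewrite -(rmorph1 jB) Fj rmorph1.
have FZ : scalable F.
  by move=> c b; rewrite -mulr_algl FM -(rmorph_alg jB) Fj rmorph_alg mulr_algl.
by exists (lrmorphism_of FD FZ (conj F1 FM)).
Qed.

Lemma gwa_lift_unique_of_span (A : algType k) (f g : {lrmorphism B -> A}) :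
  (forall d, f (jB d) = g (jB d)) -> f xB = g xB -> f yB = g yB -> f =1 g.
Proof.
move=> fgj fgx fgy b; have [h <-] := span b.
rewrite gsumE !raddf_sum; apply: eq_bigr => i _ /=; rewrite !rmorphM /= fgj.
by case: i => n; rewrite /= !rmorphXn /= ?fgx ?fgy.
Qed.

Definition gwa_of_basis : gwa s a B :=
  GWA relB gwa_lift_of_basis gwa_lift_unique_of_span.
End Recognition.
End Monomials.

(** * Maps into subalgebras, and induction over generators *)

HB.instance Definition _ (k : fieldType) (R : algType k) (P : {pred R})
  (S : subAlgType P) := GRing.Linear.on (val : S -> R).

Lemma corestrict (k : fieldType) (R A : algType k) (P : {pred R})
    (S : subAlgType P) (f : {lrmorphism A -> R}) :
  (forall b, f b \in P) ->
  exists h : {lrmorphism A -> S}, forall b, val (h b) = f b.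
Proof.
move=> fP; pose g b : S := Sub (f b) (fP b).
have vg b : val (g b) = f b by rewrite SubK.
have gD : zmod_morphism g.
  by move=> b c; apply: val_inj; rewrite raddfB /= !vg raddfB.
have gZ : scalable g.
  by move=> c b; apply: val_inj; rewrite linearZ /= !vg linearZ.
have gM : monoid_morphism g.
  split=> [|b c]; apply: val_inj.
    by rewrite rmorph1 /= vg rmorph1.
  by rewrite rmorphM /= !vg rmorphM.
by exists (lrmorphism_of gD gZ gM).
Qed.

Section Induction.
Variables (k : fieldType) (D : comAlgType k) (s : alg_aut D) (a : D).
Variables (R : algType k) (W : gwa s a R) (P : R -> Prop).

Hypothesis PD : forall r t, P r -> P t -> P (r + t).
Hypothesis PM : forall r t, P r -> P t -> P (r * t).
Hypothesis Pincl : forall d, P (gwa_incl W d).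
Hypothesis Px : P (gwa_x W).
Hypothesis Py : P (gwa_y W).

Definition gwa_ind_pred : {pred R} := [pred r | `[< P r >]].

Fact gwa_ind_closed : subalg_closed gwa_ind_pred.
Proof.
split=> [|c r t|r t]; rewrite !inE.
- by apply/asboolP; rewrite -(rmorph1 (gwa_incl W)); exact: Pincl.
- move=> /asboolP Pr /asboolP Pt; apply/asboolP/PD => //.
  (* Scaling by c is multiplication by the image of [c%:A] from D, so closure under products covers
     it. *)
  by rewrite -mulr_algl -(rmorph_alg (gwa_incl W)); exact: PM.
- by move=> /asboolP Pr /asboolP Pt; apply/asboolP/PM.
Qed.

HB.instance Definition _ :=
  GRing.isSubalgClosed.Build k R gwa_ind_pred gwa_ind_closed.

Record gwa_ind_alg : predArgType :=
  GwaIndAlg { gwa_ind_val :> R; _ : gwa_ind_val \in gwa_ind_pred }.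

HB.instance Definition _ := [isSub for gwa_ind_val].
HB.instance Definition _ := [Choice of gwa_ind_alg by <:].
HB.instance Definition _ := [SubChoice_isSubAlgebra of gwa_ind_alg by <:].

(** The elements satisfying [P] form a subalgebra containing the generators. The universal property
    maps R into it, and by uniqueness this map followed by the inclusion is the identity. *)
Lemma gwa_ind r : P r.
Proof.
pose S := gwa_ind_alg; pose v : {lrmorphism S -> R} := val.
have v_inj : injective v by exact: val_inj.
have inP t : P t -> t \in gwa_ind_pred by move=> Pt; rewrite inE; apply/asboolP.
have [j jE] := @corestrict _ _ _ _ S (gwa_incl W) (fun d => inP _ (Pincl d)).
pose x : S := Sub (gwa_x W) (inP _ Px); pose y : S := Sub (gwa_y W) (inP _ Py).
have rel : gwa_relations s a j x y.
  have [xd yd yx xy] := gwa_rel W.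
  by split=> [d|d||]; apply: v_inj; rewrite !rmorphM /= !jE.
have [f [fj fx fy]] := gwa_lift W rel.
have -> : r = v (f r).
  apply: (@gwa_lift_unique _ _ _ _ _ W _ idfun (v \o f)) => [d||] /=.
  - by rewrite fj jE.
  - by rewrite fx.
  - by rewrite fy.
by apply/asboolP; exact: (valP (f r)).
Qed.

End Induction.
(** Injectivity of [p] keeps the terms in distinct degrees; the condition on [F l] settles the case
    where no term has degree [p l]. *)
Lemma mcoeff_sumU (G : zmodType) (E : {fset int}) (F : int -> G)
    (p : int -> int) l :
  injective p -> (l \notin E -> F l = 0) ->
  (\sum_(i <- E) << F i *g p i >>)@_(p l) = F l.
Proof.
move=> p_inj F0; rewrite raddf_sum; case: (boolP (l \in E)) => [lE|lE].
  rewrite (big_fsetD1 l) //= mcoeffUU big_seq big1 ?addr0 // => i.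
  by rewrite in_fsetD1 mcoeffU (inj_eq p_inj) => /andP[/negbTE->].
rewrite F0 // big_seq big1 // => i iE; rewrite /= mcoeffU (inj_eq p_inj).
by case: eqP iE lE => // -> ->.
Qed.

(** * The monomial basis of a generalized Weyl algebra *)

Section Basis.
Variables (k : fieldType) (D : comAlgType k) (s : alg_aut D) (a : D).

Lemma gsum_ex_sum (B : algType k) (j : {lrmorphism D -> B}) (x y : B)
    (I : Type) (r : seq I) (Q : pred I) (F : I -> B) :
  (forall i, Q i -> exists f, gsum j x y f = F i) ->
  exists f, gsum j x y f = \sum_(i <- r | Q i) F i.
Proof.
move=> H; apply: (big_ind (fun b => exists f, gsum j x y f = b)) => //.
  by exists 0; rewrite raddf0.
by move=> b c [f <-] [g <-]; exists (f + g); rewrite raddfD.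
Qed.

Variables (R : algType k) (W : gwa s a R).
Let gsumW := gsum (gwa_incl W) (gwa_x W) (gwa_y W).

Lemma gwa_span r : exists f, gsumW f = r.
Proof.
pose P r := exists f, gsumW f = r.
apply: (@gwa_ind _ _ _ _ _ W P) => [_ _ [f <-] [g <-]|_ _ [f <-] [g <-]|d||].
- by exists (f + g); rewrite /gsumW raddfD.
- rewrite /gsumW !gsumE mulr_suml; apply: gsum_ex_sum => i _.
  rewrite mulr_sumr; apply: gsum_ex_sum => l _.
  have [h hE] := gsumUM s a f@_i g@_l i l.
  by exists h; rewrite (hE _ _ _ _ (gwa_rel W)).
- by exists << d *g 0 >>; rewrite /gsumW gsumU mulr1.
- by exists << 1 *g 1 >>; rewrite /gsumW gsumU rmorph1 mul1r.
- by exists << 1 *g -1 >>; rewrite /gsumW gsumU rmorph1 mul1r.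
Qed.

Hypothesis D_domain : forall d e : D, d * e = 0 -> (d == 0) || (e == 0).
Hypothesis a_neq0 : a != 0.

Lemma domain_neq0 (d e : D) : d != 0 -> e != 0 -> d * e != 0.
Proof.
move=> d0 e0; apply/eqP => /D_domain; by rewrite (negbTE d0) (negbTE e0).
Qed.

Lemma aut_iter_neq0 i (d : D) : d != 0 -> aut_iter s i d != 0.
Proof.
move=> d0; rewrite -[0](raddf0 (aut_iter s i)).
by rewrite (inj_eq (@aut_iter_inj _ _ s i)).
Qed.

Lemma skew_rel :
  gwa_relations s a (@skew_const k D s : {lrmorphism D -> skew s})
    (<< 1 *g 1 >> : skew s) (<< a *g -1 >> : skew s).
Proof.
split=> [d|d||].
- rewrite [LHS]skew_mulUU [RHS]skew_mulUU /= mul1r mulr1.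
  by rewrite add0r addr0.
- rewrite [LHS]skew_mulUU [RHS]skew_mulUU /= addr0 add0r.
  (* Commutativity of D moves s^-1(d) past a. *)
  by rewrite mulrC.
- by rewrite [LHS]skew_mulUU /= rmorph1 mulr1.
- by rewrite [LHS]skew_mulUU /= mul1r.
Qed.

(** For i = -p with p > 0, (a x^-1)^p has coefficient a s^-1(a) ... s^(1-p)(a), which is nonzero in
    a domain. *)
Lemma gmon_skew i : exists2 w : D, w != 0 &
  gmon (<< 1 *g 1 >> : skew s) (<< a *g -1 >> : skew s) i = << w *g i >>.
Proof.
case: i => n /=.
  exists 1; first exact: oner_neq0.
  elim: n => [|n IH]; first by rewrite expr0.
  by rewrite exprS IH [LHS]skew_mulUU rmorph1 mulr1.
elim: n => [|n [w w0 IH]]; first by exists a.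
exists (a * aut_iter s (-1) w); first by rewrite domain_neq0 ?aut_iter_neq0.
by rewrite exprS IH [LHS]skew_mulUU.
Qed.

(* Sending y to a x^-1 maps R to the skew Laurent ring over D, where the
   monomials stay nonzero and have different degrees. *)
Lemma gwa_free f : gsumW f = 0 -> f = 0.
Proof.
have [psi [psi_j psi_x psi_y]] := gwa_lift W skew_rel.
pose u : skew s := << 1 *g 1 >>; pose v : skew s := << a *g -1 >>.
have psi_mon i : psi (gmon (gwa_x W) (gwa_y W) i) = gmon u v i.
  by case: i => n; rewrite /= rmorphXn /= ?psi_x ?psi_y.
move=> /(congr1 psi); rewrite raddf0 /gsumW gsumE raddf_sum /=.
have wP i : exists w : D, (w != 0) && (gmon u v i == << w *g i >>).
  by have [w w0 E] := gmon_skew i; exists w; rewrite w0 E eqxx.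
pose w i := xchoose (wP i).
have wE i : (w i != 0) && (gmon u v i == << w i *g i >>) := xchooseP (wP i).
under eq_bigr => i _.
  rewrite rmorphM /= psi_j psi_mon; have /andP[_ /eqP->] := wE i.
  rewrite [_ * _]skew_mulUU add0r /=; over.
move=> sum0; apply/malgP => l; rewrite mcoeff0.
have : f@_l * w l = 0.
  rewrite -(@mcoeff_sumU _ (msupp f) (fun i => f@_i * w i) id l) //.
    by rewrite [X in X@_ _]sum0 mcoeff0.
  by move=> /mcoeff_outdom ->; rewrite mul0r.
have /andP[wl _] := wE l.
by move=> /D_domain/orP[/eqP//|]; rewrite (negbTE wl).
Qed.

(** D sits in R as the combinations concentrated in degree 0, to which freeness applies. *)
Lemma gwa_incl_inj : injective (gwa_incl W).
Proof.
move=> d e de; apply/eqP; rewrite -subr_eq0 -(monalgU_eq0 _ (0 : int)).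
by apply/eqP/gwa_free; rewrite /gsumW gsumU raddfB /= de subrr mul0r.
Qed.

End Basis.

Lemma prim_root_neq0 (k : fieldType) (n : nat) (z : k) :
  n.-primitive_root z -> z != 0.
Proof.
move=> ord_z; apply: contra_eq_neq (prim_expr_order ord_z) => ->.
by rewrite expr0n gtn_eqF ?(prim_order_gt0 ord_z) // eq_sym oner_neq0.
Qed.

(** * The fixed ring when x and y are scaled and D is acted on by [tau] *)

Section FixedGwa.
Variables (k : fieldType) (D D' : comAlgType k) (s : alg_aut D) (a : D).
Variables (R : algType k) (W : gwa s a R) (phi : alg_aut R).
Variables (s' : alg_aut D') (iota : {lrmorphism D' -> D}).
Variables (tau : {lrmorphism D -> D}) (mu : k) (m n : nat).

Hypothesis D_domain : forall d e : D, d * e = 0 -> (d == 0) || (e == 0).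
Hypothesis a_neq0 : a != 0.
Hypothesis phi_incl : forall d, phi (gwa_incl W d) = gwa_incl W (tau d).
Hypothesis phi_x : phi (gwa_x W) = mu^-1 *: gwa_x W.
Hypothesis phi_y : phi (gwa_y W) = mu *: gwa_y W.
Hypothesis ord_mu : m.-primitive_root mu.
Hypothesis tau_order : forall d, iter n tau d = d.
Hypothesis coprime_mn : coprime m n.
Hypothesis iota_inj : injective iota.
Hypothesis tau_iota : forall d, tau (iota d) = iota d.
Hypothesis tau_fixed : forall d, tau d = d -> exists d', iota d' = d.
Hypothesis iota_s : forall d, iota (s' d) = aut_iter s m%:Z (iota d).

Let x := gwa_x W.
Let y := gwa_y W.
Let incl := gwa_incl W.

Let mu_neq0 : mu != 0 := prim_root_neq0 ord_mu.

(** Here d is the product of s^-i(a) for i < p: the inner factor yx = a of y^(p+1) x^(p+1) becomes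
    s^-p(a) when moved left past y^p. The second product is s^p(d), as the relations for x^p and y^p
    demand. *)
Lemma yx_expn (p : nat) : exists d, [/\ d != 0, y ^+ p * x ^+ p = incl d &
  x ^+ p * y ^+ p = incl (aut_iter s p d)].
Proof.
have [xd yd yx xy] := gwa_rel W.
elim: p => [|p [d [d0 IH1 IH2]]].
  by exists 1; rewrite !rmorph1 !expr0 mulr1 oner_neq0.
exists (aut_iter s (- p%:Z) a * d); split.
- by rewrite domain_neq0 ?aut_iter_neq0.
- rewrite exprSr exprS mulrA -(mulrA _ y) yx -(gmonN x y p).
  by rewrite (gmon_comm (gwa_rel W)) gmonN -mulrA IH1 rmorphM.
(* Grouped as x (x^p y^p) y, the product is s^(p+1)(d) s(a), and s(a) = s^(p+1)(s^-p(a)). *)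
rewrite exprS exprSr mulrA -(mulrA x) IH2 xd -mulrA xy -rmorphM mulrC.
congr (incl _); rewrite rmorphM /=.
rewrite -[s (iter _ _ (aut_iter _ _ _))]/(aut_iter s p.+1 _).
by rewrite -aut_iterD -addn1 PoszD addrAC subrr.
Qed.

Lemma phi_gmon i : phi (gmon x y i) = mu ^ (- i) *: gmon x y i.
Proof.
case: i => p /=; rewrite rmorphXn /= ?phi_x ?phi_y exprZn.
  by rewrite exprVn exprnN.
by rewrite NegzE opprK.
Qed.

(** Applying [tau] n times gives mu^(i n) = 1, so m divides i n, and coprimality leaves m dividing
    i. *)
Lemma tau_eigen i d : d != 0 -> tau d = mu ^ i *: d -> (m %| i)%Z.
Proof.
move=> d0 td.
have itd (p : nat) : iter p tau d = (mu ^ i) ^+ p *: d.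
  elim: p => [|p IH]; first by rewrite expr0 scale1r.
  by rewrite /= IH linearZ /= td scalerA -exprSr.
have : (mu ^ i) ^+ n = 1.
  have /eqP := itd n; rewrite tau_order eq_sym -subr_eq0 -[X in _ - X]scale1r.
  by rewrite -scalerBl scaler_eq0 (negbTE d0) orbF subr_eq0 => /eqP.
rewrite dvdzE absz_nat => E; rewrite -(Gauss_dvdl _ coprime_mn).
rewrite (prim_order_dvd ord_mu) exprM.
(* For negative exponents the equation is inverted, as the divisibility test uses natural powers. *)
case: i E {td itd} => p; first by move=> ->.
rewrite -[mu ^ _]/((mu ^+ p.+1)^-1) exprVn /= => /(congr1 GRing.inv).
by rewrite invrK invr1 => ->.
Qed.

(** The image under [phi] has coefficients mu^-i tau(f_i), and by freeness coefficients can be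
    compared. *)
Lemma fixed_coef f l : phi (gsum incl x y f) = gsum incl x y f ->
  tau f@_l = mu ^ l *: f@_l.
Proof.
move=> fixf.
pose F i := mu ^ (- i) *: tau f@_i.
have fE : \sum_(i <- msupp f) << F i *g i >> = f.
  apply/eqP; rewrite -subr_eq0; apply/eqP/(gwa_free (W := W)) => //.
  rewrite raddfB /= -[X in _ - X]fixf; apply/eqP; rewrite subr_eq0; apply/eqP.
  rewrite raddf_sum [in RHS]gsumE (raddf_sum phi); apply: eq_bigr => i _ /=.
  rewrite rmorphM /= phi_incl phi_gmon gsumU /F linearZ /=.
  by rewrite -scalerAl scalerAr.
have := @mcoeff_sumU _ (msupp f) F id l (@inj_id _); rewrite fE => E.
rewrite [in RHS]E.
  by rewrite /F scalerA -expfzDr // subrr scale1r.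
by rewrite /F => /mcoeff_outdom ->; rewrite raddf0 scaler0.
Qed.

Theorem fixed_gwa :
  exists2 a' : D', a' != 0 & inhabited (gwa s' a' (fixed_ring phi)).
Proof.
have rel := gwa_rel W.
have m_gt0 : (0 < m)%N := prim_order_gt0 ord_mu.
have mum : mu ^+ m = 1 := prim_expr_order ord_mu.
have phiX : phi (x ^+ m) = x ^+ m.
  by rewrite rmorphXn /= phi_x exprZn exprVn mum invr1 scale1r.
have phiY : phi (y ^+ m) = y ^+ m.
  by rewrite rmorphXn /= phi_y exprZn mum scale1r.
have [d [d0 yxd xyd]] := yx_expn m.
(* Both y^m and x^m are fixed by [phi], hence so is their product d; thus d descends to the new
   defining element [a'] in D'. *)
have td : tau d = d.
  apply: (gwa_incl_inj (W := W)) => //.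
  by rewrite -phi_incl -/incl -yxd rmorphM /= phiX phiY.
have [a' a'E] := tau_fixed td.
exists a'; first by apply: contraNneq d0 => a0; rewrite -a'E a0 raddf0.
have fixP r : phi r = r -> r \in fixed_pred phi by move=> E; rewrite inE E.
have jP b : (incl \o iota) b \in fixed_pred phi.
  by apply: fixP; rewrite /= phi_incl tau_iota.
have [j jE] := @corestrict _ _ _ _ (fixed_ring phi) _ jP.
pose v : {lrmorphism fixed_ring phi -> R} := val.
have v_inj : injective v by exact: val_inj.
pose X : fixed_ring phi := Sub (x ^+ m) (fixP _ phiX).
pose Y : fixed_ring phi := Sub (y ^+ m) (fixP _ phiY).
have rel' : gwa_relations s' a' j X Y.
  split=> [b|b||]; apply: v_inj; rewrite !rmorphM /= !jE /=.
  - by rewrite iota_s -(gmon_comm rel m).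
  - rewrite -!(gmonN x y m) (gmon_comm rel); congr (incl _ * _).
    (* [iota_s] speaks of [s'] and not of its inverse, so s^m is applied to both sides first. *)
    apply: (@aut_iter_inj _ _ s m); rewrite -iota_s aut_invK -aut_iterD subrr.
    by [].
  - by rewrite yxd a'E.
  - by rewrite iota_s a'E xyd.
have v_gmon i : v (gmon X Y i) = gmon x y (m%:Z * i).
  case: i => p; first by rewrite -PoszM [LHS](rmorphXn v) /= -exprM.
  by rewrite [LHS](rmorphXn v) /= -exprM NegzE mulrN -PoszM gmonN.
have v_term b i : v (j b * gmon X Y i) = incl (iota b) * gmon x y (m%:Z * i).
  by rewrite -v_gmon [LHS](rmorphM v) /= jE.
constructor; apply: (gwa_of_basis rel') => [r|f].
  (* Spanning: in the expansion of a fixed element a nonzero coefficient forces m to divide its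
     degree i. Then mu^i = 1, so the coefficient is fixed by [tau] and lies in the image of
     [iota]. *)
  have [f fE] := gwa_span W (v r).
  have coefE l : tau f@_l = mu ^ l *: f@_l.
    by apply: fixed_coef; rewrite fE; have /eqP := valP r.
  have term i : exists t : {malg D'[int]},
      v (gsum j X Y t) == incl f@_i * gmon x y i.
    have [->|fi0] := eqVneq f@_i 0.
      by exists 0; rewrite !raddf0 mul0r.
    have mi := tau_eigen fi0 (coefE i).
    have fi_fix : tau f@_i = f@_i.
      rewrite coefE; have /dvdzP[q ->] := mi.
      by rewrite mulrC -exprz_exp -exprnP mum exp1rz scale1r.
    have [b bE] := tau_fixed fi_fix.
    exists << b *g (i %/ m)%Z >>; rewrite gsumU v_term bE.
    by rewrite mulrC divzK.
  pose t i := xchoose (term i).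
  exists (\sum_(i <- msupp f) t i); apply: v_inj.
  rewrite -fE [in RHS]gsumE (raddf_sum (gsum j X Y)) (raddf_sum v).
  apply: eq_bigr => i _.
  exact/eqP/(xchooseP (term i)).
(* Independence: a relation in the fixed ring is one in R with all degrees multiplied by m. *)
move=> sum0.
have m_inj : injective (fun i : int => m%:Z * i).
  by apply: mulfI; rewrite eqz_nat -lt0n.
pose h : {malg D[int]} := \sum_(i <- msupp f) << iota f@_i *g m%:Z * i >>.
have h0 : h = 0.
  apply: (gwa_free (W := W)) => //.
  rewrite -[RHS](raddf0 v) -sum0 [in RHS]gsumE.
  rewrite /h (raddf_sum (gsum _ _ _)) (raddf_sum v); apply: eq_bigr => i _.
  by rewrite /= gsumU -v_term.
apply/malgP => l; rewrite mcoeff0; apply: iota_inj; rewrite raddf0.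
rewrite -(@mcoeff_sumU _ (msupp f) (fun i => iota f@_i) _ l m_inj).
  by rewrite -/h h0 mcoeff0.
by move=> /mcoeff_outdom ->; rewrite raddf0.
Qed.
End FixedGwa.

(** * Laurent polynomials: monomials, evaluation, absence of zero divisors *)

Section Laurent.
Variable k : fieldType.
Implicit Types (c d : k) (i j : int) (f : laurent k).

Lemma lmonM c d i j :
  (lmon c i : laurent k) * lmon d j = lmon (c * d) (i + j).
Proof. exact: lmulmm. Qed.

Lemma lmonZ c d i : c *: (lmon d i : laurent k) = lmon (c * d) i.
Proof. by rewrite [LHS]lscaleE lmulmm add0r. Qed.

Lemma lmonV c i : c != 0 -> (lmon c i : laurent k)^-1 = lmon c^-1 (- i).
Proof. by move=> c0; apply: mulr1_eq; rewrite lmonM mulfV // addrN. Qed.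

Lemma lmon_unit c i : c != 0 -> (lmon c i : laurent k) \is a GRing.unit.
Proof.
move=> c0; apply/unitrPr; exists (lmon c^-1 (- i)).
by rewrite lmonM mulfV // addrN.
Qed.

Lemma lmonXn c i (n : nat) :
  (lmon c i : laurent k) ^+ n = lmon (c ^+ n) (i * n).
Proof.
elim: n => [|n IH]; first by rewrite !expr0 mulr0.
by rewrite !exprS IH lmonM -[n.+1]add1n PoszD mulrDr mulr1.
Qed.

Lemma lmonXz c i j : c != 0 ->
  (lmon c i : laurent k) ^ j = lmon (c ^ j) (i * j).
Proof.
move=> c0; case: j => n; first by rewrite -!exprnP lmonXn.
by rewrite NegzE -!exprnN lmonXn lmonV ?expf_neq0 // mulrN.
Qed.

Lemma lmonE c i : lmon c i = c *: lvar k ^ i.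
Proof. by rewrite lmonXz ?oner_neq0 // exp1rz mul1r lmonZ mulr1. Qed.

Lemma lrmorph_laurentE (A : unitAlgType k) (F : {lrmorphism laurent k -> A}) f :
  F f = \sum_(i <- msupp f) f@_i *: F (lvar k) ^ i.
Proof.
rewrite [f in LHS](lsum f) raddf_sum; apply: eq_bigr => i _ /=.
by rewrite lmonE linearZ /= rmorphXz // lmon_unit ?oner_neq0.
Qed.

(** Evaluation at [u]; for a unit, u^(i+j) = u^i u^j holds for all integers, whence
    multiplicativity. *)
Lemma laurent_lift (A : comUnitAlgType k) (u : A) : u \is a GRing.unit ->
  exists F : {lrmorphism laurent k -> A}, F (lvar k) = u.
Proof.
move=> uu; pose F (f : laurent k) : A := mmap (in_alg A) (fun i => u ^ i) f.
have FU c i : F (lmon c i) = c *: u ^ i by rewrite /F mmapU mulr_algl.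
have FD : zmod_morphism F by move=> f g; exact: raddfB.
pose Fa : {additive laurent k -> A} :=
  HB.pack F (GRing.isZmodMorphism.Build (laurent k) A F FD).
have FS (r : seq int) (g : int -> laurent k) :
    F (\sum_(i <- r) g i) = \sum_(i <- r) F (g i) by exact: (raddf_sum Fa).
have FM : monoid_morphism F.
  split=> [|f g]; first by rewrite [LHS](FU 1 0) scale1r.
  rewrite [f](lsum f) [g](lsum g) mulr_suml !FS mulr_suml.
  apply: eq_bigr => i _; rewrite mulr_sumr FS mulr_sumr.
  apply: eq_bigr => j _; rewrite lmonM !FU exprzDr //.
  by rewrite -scalerAl -scalerAr scalerA.
have FZ : scalable F.
  move=> c f; rewrite [f](lsum f) scaler_sumr !FS scaler_sumr.
  by apply: eq_bigr => i _; rewrite lmonZ !FU scalerA.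
by exists (lrmorphism_of FD FZ FM); rewrite [LHS](FU 1 1) scale1r.
Qed.

(** The terms of highest degree multiply to a nonzero term that nothing cancels. *)
Lemma laurent_domain (f g : laurent k) : f * g = 0 -> (f == 0) || (g == 0).
Proof.
apply: contra_eqT; rewrite negb_or => /andP[f0 g0].
have nz (u : {malg k[int]}) : u != 0 -> (msupp u : seq int) != [::].
  by apply: contra => /eqP E; rewrite [u]lsum E big_nil.
have [i fi i_max] := exists_max (nz _ f0).
have [j gj j_max] := exists_max (nz _ g0).
have : (lmul f g)@_(i + j) != 0.
  apply: (@lmul_extremal _ (fun a b => a <= b)) => //.
    move=> a b nb le1 le2; apply: contra nb => /eqP E.
    by rewrite eq_le le2 -(lerD2l i) -E lerD2r.
  move=> a b na le1 le2; apply: contra na => /eqP E.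
  by rewrite eq_le le1 -(lerD2r j) -E lerD2l.
by apply: contraNneq => E; rewrite [lmul f g]E mcoeff0.
Qed.

End Laurent.

(** * Morphisms out of the base rings k[h] and k[h, h^-1] *)

Section Base.
Variables (k : fieldType) (b : base_kind).
Local Notation D := (base_ring k b).
Local Notation h := (base_var k b).

Lemma base_ext (A : algType k) (f g : {lrmorphism D -> A}) :
  f h = g h -> f =1 g.
Proof.
case: b f g => /= f g fgX p.
  rewrite -[p]coefK poly_def !raddf_sum; apply: eq_bigr => i _ /=.
  by rewrite !linearZ /= !rmorphXn /= fgX.
(* The target has no inverse operation, so this is uniqueness of inverses by hand: f(h^-1) = f(h^-1)
   g(h) g(h^-1) = f(h^-1) f(h) g(h^-1) = g(h^-1). *)
have fgV : f (lvar k)^-1 = g (lvar k)^-1.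
  have vU : lvar k \is a GRing.unit by rewrite lmon_unit ?oner_neq0.
  rewrite -[LHS]mulr1 -(rmorph1 g) -(mulrV vU) (rmorphM g) /= -fgX mulrA.
  by rewrite -(rmorphM f) mulVr // (rmorph1 f) mul1r.
rewrite [p](lsum p) !raddf_sum; apply: eq_bigr => i _ /=.
rewrite lmonE !linearZ /=; congr (_ *: _).
case: {p} i => n; first by rewrite -exprnP !rmorphXn /= fgX.
by rewrite NegzE -exprnN -exprVn !rmorphXn /= fgV.
Qed.

(** The case n = 1 gives scalings of h, the case c = 1 the power map. A nonzero c makes the image of
    h a unit in the Laurent case. *)
Lemma base_lift (c : k) (n : nat) : c != 0 ->
  exists F : {lrmorphism D -> D}, F h = c *: h ^+ n.
Proof.
move=> c0; case: b => /=.
  by exists (comp_poly (c *: 'X^n)); rewrite /= comp_polyX.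
apply: (@laurent_lift k (laurent k)).
by rewrite lmonXn lmonZ lmon_unit // mulf_neq0 // expf_neq0 ?oner_neq0.
Qed.

Lemma base_domain (d e : D) : d * e = 0 -> (d == 0) || (e == 0).
Proof.
case: b d e => /= d e; last exact: laurent_domain.
by move/eqP; rewrite mulf_eq0.
Qed.

Lemma base_scaling (c : k) : c != 0 -> exists s : alg_aut D, s h = c *: h.
Proof.
move=> c0; have [F FE] := base_lift 1 c0.
have [G GE] := base_lift 1 (invr_neq0 c0); rewrite !expr1 in FE GE.
have FK : cancel F G.
  apply: (base_ext (f := G \o F) (g := idfun)).
  by rewrite /= FE linearZ /= GE scalerA divff // scale1r.
have GK : cancel G F.
  apply: (base_ext (f := F \o G) (g := idfun)).
  by rewrite /= GE linearZ /= FE scalerA mulVf // scale1r.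
by exists (AlgAut FK GK).
Qed.

End Base.

(** * The substitution of h^n for h, and its image *)

Section Power.
Variables (k : fieldType) (b : base_kind).
Local Notation D := (base_ring k b).
Local Notation h := (base_var k b).
Variables (n : nat) (iota : {lrmorphism D -> D}).
Hypotheses (n_gt0 : (0 < n)%N) (iota_h : iota h = h ^+ n).

(** The coefficient of h^i in d reappears as that of h^(n i) in [iota d]. *)
Lemma base_power_inj : injective iota.
Proof.
case: b iota iota_h => /= F Fh d e.
  have FE : F =1 comp_poly 'X^n.
    apply: (@base_ext k PolyBase {poly k} F (comp_poly 'X^n)).
    by rewrite Fh /= comp_polyX.
  rewrite !FE => E; apply/polyP => i.
  have := congr1 (fun p : {poly k} => p`_(n * i)) E.
  by rewrite !coef_comp_poly_Xn // dvdn_mulr // mulKn.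
have n_inj : injective (fun i : int => n%:Z * i).
  by apply: mulfI; rewrite eqz_nat -lt0n.
have FE f l : (F f : {malg k[int]})@_(n%:Z * l) = f@_l.
  rewrite lrmorph_laurentE Fh.
  rewrite -(@mcoeff_sumU _ (msupp f) (mcoeff^~ f) _ l n_inj).
    congr (mcoeff _ _); apply: eq_bigr => i _.
    rewrite lmonXn lmonXz ?expf_neq0 ?oner_neq0 // expr1n exp1rz.
    by rewrite lmonZ mulr1 mul1r.
  exact: mcoeff_outdom.
by move=> E; apply/malgP => l; rewrite -(FE d) -(FE e) E.
Qed.

(** Since [tau] multiplies the coefficient of h^i by gamma^i, a fixed element has only exponents
    with gamma^i = 1, the multiples of n. *)
Lemma base_fixed (gamma : k) (tau : {lrmorphism D -> D}) (d : D) :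
  n.-primitive_root gamma -> tau h = gamma *: h -> tau d = d ->
  exists d', iota d' = d.
Proof.
move=> ord_gamma.
have gamma0 := prim_root_neq0 ord_gamma.
have fixE (c e : k) : c * e = c -> c != 0 -> e = 1.
  by move=> ce c0; apply: (mulfI c0); rewrite ce mulr1.
case: b iota iota_h tau d => /= F Fh tau d tauh td.
  have tauE i : d`_i * gamma ^+ i = d`_i.
    have tauC : tau =1 comp_poly (gamma *: 'X).
      by apply: (@base_ext k PolyBase {poly k}); rewrite tauh /= comp_polyX.
    rewrite -[in RHS]td tauC comp_polyE.
    under eq_bigr do rewrite exprZn scalerA.
    rewrite (_ : \sum_(i < _) _ =
      \poly_(i < size d) (d`_i * gamma ^+ i)); last first.
      by rewrite poly_def.
    by rewrite coef_poly; case: ltnP => // ?; rewrite nth_default ?mul0r.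
  have dvd i : d`_i != 0 -> (n %| i)%N.
    by move=> di; rewrite (prim_order_dvd ord_gamma) (fixE _ _ (tauE i) di).
  (* The bound [size d] is generous: for i at or beyond it, n i is too, as n > 0. *)
  exists (\poly_(i < size d) d`_(n * i)).
  have -> : F =1 comp_poly 'X^n.
    apply: (@base_ext k PolyBase {poly k} F (comp_poly 'X^n)).
    by rewrite Fh /= comp_polyX.
  apply/polyP => i; rewrite coef_comp_poly_Xn //.
  case: (boolP (n %| i)%N) => [ni|]; last first.
    by apply: contraNeq; rewrite eq_sym => /dvd.
  rewrite coef_poly mulnC divnK //; case: ltnP => // le.
  by rewrite nth_default // (leq_trans le) // leq_div.
have tauE i : d@_i * gamma ^ i = d@_i.
  rewrite -[in RHS]td lrmorph_laurentE tauh.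
  pose F' i := d@_i * gamma ^ i.
  rewrite -[LHS]/(F' i) -(@mcoeff_sumU _ (msupp d) F' id i (@inj_id _)).
    congr (mcoeff _ _); apply: eq_bigr => l _.
    by rewrite lmonZ mulr1 lmonXz // lmonZ mul1r.
  by rewrite /F' => /mcoeff_outdom ->; rewrite mul0r.
have dvd i : i \in msupp d -> (n %| i)%Z.
  rewrite -mcoeff_neq0 => /(fixE _ _ (tauE i)) gi.
  rewrite dvdzE absz_nat (prim_order_dvd ord_gamma); apply/eqP.
  case: i gi => p // /(congr1 GRing.inv).
  by rewrite -[gamma ^ _]/((gamma ^+ p.+1)^-1) invrK invr1.
exists (\sum_(i <- msupp d) lmon d@_i (i %/ n)%Z).
rewrite raddf_sum [RHS](lsum d) !big_seq; apply: eq_bigr => i /dvd ni /=.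
rewrite lmonE linearZ /= rmorphXz ?lmon_unit ?oner_neq0 //= Fh lmonXn expr1n.
by rewrite lmonXz ?oner_neq0 // exp1rz lmonZ mulr1 mul1r mulrC divzK.
Qed.
End Power.

Theorem corollary3p5 (k : fieldType) (R : algType k) (W : quantum_gwa R)
    (a_nonunit : q_a W \isn't a GRing.unit)
    (a_nonsymmetric : ~ lsymmetric (q_laurent W))
    (gamma mu : k) (n m : nat)
    (ord_gamma : n.-primitive_root gamma) (ord_mu : m.-primitive_root mu)
    (i0 : int) (phi : alg_aut R) (phi_eta : is_eta W i0 gamma mu%:A phi)
    (n_dvd_i0 : (n %| i0)%Z) (coprime_mn : gcdn m n = 1%N) :
  inhabited (scaling_gwa (fixed_ring phi)) /\
  (q_param W ^+ (m * n) != 1 -> inhabited (quantum_gwa (fixed_ring phi))).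
Proof.
have n_gt0 := prim_order_gt0 ord_gamma.
have gamma0 := prim_root_neq0 ord_gamma.
have mu0 := prim_root_neq0 ord_mu.
have [_ [phi_h phi_y phi_x]] := phi_eta.
pose h := base_var k (q_base W).
(* [tau] is the action of [phi] on D. The subring generated by h^n (and its inverse) is modelled by
   D itself through [iota], and there s^m acts as scaling by q^(m n), which is [s']. *)
have [tau tau_h] := base_scaling (q_base W) gamma0.
have [iota iota_h] := base_lift (q_base W) n (oner_neq0 k).
rewrite scale1r in iota_h.
have q_neq0 : q_param W ^+ (m * n) != 0 by rewrite expf_neq0 ?q_param_neq0.
have [s' s'_h] := base_scaling (q_base W) q_neq0.
have phi_incl d : phi (gwa_incl W d) = gwa_incl W (tau d).
  apply: (base_ext (f := phi \o gwa_incl W) (g := gwa_incl W \o tau)) => /=.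
  by rewrite phi_h tau_h linearZ.
have mu_x : phi (gwa_x W) = mu^-1 *: gwa_x W.
  have muV : (mu%:A : base_ring k (q_base W))^-1 = mu^-1%:A.
    by apply: mulr1_eq; rewrite -scalerAl mul1r scalerA divff ?scale1r.
  (* As n divides i0, the factor gamma^i0 in the action on x is 1. *)
  have /dvdzP[q i0E] := n_dvd_i0.
  rewrite phi_x muV rmorph_alg mulr_algl i0E mulrC -exprz_exp -exprnP.
  by rewrite (prim_expr_order ord_gamma) exp1rz scale1r.
have mu_y : phi (gwa_y W) = mu *: gwa_y W.
  by rewrite phi_y rmorph_alg mulr_algr.
have tau_order d : iter n tau d = d.
  (* Rewritten with [aut_iter], the iterate is an algebra morphism and can be tested on h alone. *)
  rewrite -[LHS]/(aut_iter tau n d).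
  apply: (base_ext (f := aut_iter tau n) (g := idfun)) => /=.
  rewrite -[RHS]scale1r -(prim_expr_order ord_gamma).
  elim: {n_dvd_i0 coprime_mn iota_h s'_h q_neq0 ord_gamma n_gt0} n => [|p IH].
    by rewrite expr0 scale1r.
  by rewrite /= IH linearZ /= tau_h scalerA -exprSr.
have tau_iota d : tau (iota d) = iota d.
  apply: (base_ext (f := tau \o iota) (g := iota)) => /=.
  rewrite iota_h rmorphXn /= tau_h exprZn.
  by rewrite (prim_expr_order ord_gamma) scale1r.
have sigma_h : aut_iter (q_sigma W) m h = q_param W ^+ m *: h.
  elim: {n_dvd_i0 coprime_mn s'_h q_neq0 ord_mu} m => [|p IH].
    by rewrite expr0 scale1r.
  by rewrite /= in IH *; rewrite IH linearZ /= q_sigma_var scalerA -exprSr.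
have iota_s d : iota (s' d) = aut_iter (q_sigma W) m%:Z (iota d).
  pose sm : {lrmorphism _ -> _} := aut_iter (q_sigma W) m.
  apply: (base_ext (f := iota \o s') (g := sm \o iota)).
  rewrite /= s'_h linearZ /= iota_h -[RHS]/(sm _) rmorphXn /=.
  by rewrite [iter _ _ _]sigma_h exprZn -exprM.
have [a' a'0 [W']] := fixed_gwa (@base_domain k (q_base W)) (q_a_neq0 W)
  phi_incl mu_x mu_y ord_mu tau_order (introT eqP coprime_mn)
  (base_power_inj n_gt0 iota_h) tau_iota
  (fun d => @base_fixed _ _ _ _ n_gt0 iota_h _ tau d ord_gamma tau_h) iota_s.
pose S : scaling_gwa (fixed_ring phi) := ScalingGWA q_neq0 s'_h a'0 W'.
split; first by constructor.
by move=> q1; constructor; exact: (@QuantumGWA _ _ S q1).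
Qed.
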